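(* The Nichols algebra $\mathfrak B(V_{3,3})$ is, as an algebra, the algebra generated by the elements $x=e_1$, $y=e_2$ subject to the relations $$x^2-2y^2=0,\qquad xy+yx=0,\qquad y^4=0.$$ In particular, $\dim\mathfrak B(V_{3,3})=8$.
   Context: $\Bbbk$ is an algebraically closed field of characteristic zero and $\xi\in\Bbbk$ is a fixed primitive $4$-th root of unity. $\mathcal K$ is the $8$-dimensional Hopf algebra over $\Bbbk$ generated as an algebra by $a,b,c,d$ with relations $ab=\xi ba$, $ac=\xi ca$, $cb=bc=0$, $cd=\xi dc$, $bd=\xi db$, $ad=da$, $ad=1$, $b^2=c^2=0$, $a^2c=b$, $a^4=1$, with $\Delta(a)=a\otimes a+b\otimes c$, $\Delta(b)=a\otimes b+b\otimes d$, $\Delta(c)=c\otimes a+d\otimes c$, $\Delta(d)=c\otimes b+d\otimes d$, $\varepsilon(a)=\varepsilon(d)=1$, $\varepsilon(b)=\varepsilon(c)=0$, $\mathcal S(a)=d$, $\mathcal S(b)=\xi b$, $\mathcal S(c)=-\xi c$, $\mathcal S(d)=a$. ${}^{\mathcal K}_{\mathcal K}\mathcal{YD}$ is the category of left Yetter-Drinfeld modules over $\mathcal K$: left modules and left comodules $M$ (coaction $\delta(m)=m_{(-1)}\otimes m_{(0)}$) with $\delta(h\cdot m)=h_{(1)}m_{(-1)}\mathcal S(h_{(3)})\otimes h_{(2)}\cdot m_{(0)}$; its braiding is $c_{M,N}(m\otimes n)=m_{(-1)}\cdot n\otimes m_{(0)}$. The Nichols algebra $\mathfrak B(V)$ is the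 (unique up to isomorphism) $\mathbb N$-graded braided Hopf algebra $R=\bigoplus_{n\ge0}R(n)$ in this category with $R(0)\simeq\Bbbk$, $R(1)\simeq V$, $R(1)$ equal to the space of primitive elements of $R$, and $R$ generated as an algebra by $R(1)$. For $i\in\mathbb Z_4$ and $\lambda=\xi^i$, $V_{i,3}\in{}^{\mathcal K}_{\mathcal K}\mathcal{YD}$ has basis $e_1,e_2$, action $a\cdot e_1=\lambda e_1$, $b\cdot e_1=c\cdot e_1=0$, $d\cdot e_1=\lambda^{-1}e_1$, $a\cdot e_2=-\xi\lambda e_2$, $b\cdot e_2=\lambda^2e_1$, $c\cdot e_2=e_1$, $d\cdot e_2=\xi\lambda^{-1}e_2$, and coaction $\delta(e_1)=a\otimes e_1+(\lambda^3+\xi\lambda)b\otimes e_2$, $\delta(e_2)=d\otimes e_2+\frac12(\lambda-\xi\lambda^3)c\otimes e_1$. Here $i=3$, $\lambda=-\xi$. *)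

(* Defs.v *)
From HB Require Import structures.
From mathcomp Require Import all_boot all_order all_algebra generic_quotient.
From mathcomp Require Import boolp.
From mathcomp Require Import finmap monalg.

Set Implicit Arguments.
Unset Strict Implicit.
Unset Printing Implicit Defensive.

Import GRing.Theory.
Local Open Scope ring_scope.
Local Open Scope quotient_scope.

Reserved Notation "u ⊗ v" (at level 40, left associativity).
Reserved Notation "\sw ( u , v <- t ) E"
  (at level 36, E at level 36, u name, v name, t at level 50,
   format "'[' \sw ( u ,  v  <-  t ) '/  '  E ']'").

Definition bilinear_map (k : fieldType) (U V W : lmodType k)
    (f : U -> V -> W) : Prop :=
  (forall u, linear (f u)) /\ (forall v, linear (f^~ v)).

Section LinearFacts.
Variables (k : fieldType) (U W : lmodType k) (g : U -> W).
Hypothesis gl : linear g.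

Lemma lin0 : g 0 = 0.
Proof. by have := gl (-1) 0 0; rewrite scaler0 addr0 scaleN1r addNr. Qed.

Lemma linZ c u : g (c *: u) = c *: g u.
Proof. by rewrite -[c *: u]addr0 gl lin0 addr0. Qed.
End LinearFacts.

Section Tensor.
Variables (k : fieldType) (U V : lmodType k).

(* The list [:: (u1, v1); ...] stands for the formal sum u1 ⊗ v1 + ...; two
   formal sums are the same tensor when no bilinear map separates them. *)
Definition tens_eqv (s t : seq (U * V)) : bool :=
  `[< forall (W : lmodType k) (f : U -> V -> W), bilinear_map f ->
      \sum_(p <- s) f p.1 p.2 = \sum_(p <- t) f p.1 p.2 >].

Lemma tens_eqv_refl : reflexive tens_eqv.
Proof. by move=> s; apply/asboolP. Qed.

Lemma tens_eqv_sym : symmetric tens_eqv.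
Proof.
by move=> s t; apply/asboolP/asboolP => e W f fb; rewrite (e W f fb).
Qed.

Lemma tens_eqv_trans : transitive tens_eqv.
Proof.
move=> t s r /asboolP e1 /asboolP e2; apply/asboolP => W f fb.
by rewrite (e1 W f fb) (e2 W f fb).
Qed.

Canonical tens_equiv :=
  EquivRel tens_eqv tens_eqv_refl tens_eqv_sym tens_eqv_trans.

Definition tensor := {eq_quot tens_eqv}.
HB.instance Definition _ := Choice.on tensor.
HB.instance Definition _ := EqQuotient.on tensor.

Definition tens (u : U) (v : V) : tensor := \pi_tensor [:: (u, v)].

(* Total, but only meaningful for a bilinear f: see tliftE. *)
Definition tlift (W : lmodType k) (f : U -> V -> W) (t : tensor) : W :=
  \sum_(p <- repr t) f p.1 p.2.

Lemma tlift_pi (W : lmodType k) (f : U -> V -> W) (s : seq (U * V)) :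
  bilinear_map f -> tlift f (\pi_tensor s) = \sum_(p <- s) f p.1 p.2.
Proof.
move=> fb; have /eqquotP /asboolP e : repr (\pi_tensor s) = s %[mod tensor].
  by rewrite reprK.
exact: e.
Qed.

Lemma tensor_eqP (t1 t2 : tensor) :
  (forall (W : lmodType k) (f : U -> V -> W), bilinear_map f ->
      tlift f t1 = tlift f t2) -> t1 = t2.
Proof.
move=> e; rewrite -[t1]reprK -[t2]reprK; apply/eqquotP/asboolP => W f fb.
exact: e.
Qed.

Definition tzero : tensor := \pi_tensor [::].
Definition tadd (s t : tensor) : tensor := \pi_tensor (repr s ++ repr t).
Definition tscale (c : k) (t : tensor) : tensor :=
  \pi_tensor [seq (c *: p.1, p.2) | p <- repr t].
Definition topp (t : tensor) : tensor := tscale (-1) t.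

Section Lift.
Variables (W : lmodType k) (f : U -> V -> W).
Hypothesis fb : bilinear_map f.

Lemma tlift0 : tlift f tzero = 0.
Proof. by rewrite tlift_pi // big_nil. Qed.

Lemma tliftD s t : tlift f (tadd s t) = tlift f s + tlift f t.
Proof. by rewrite tlift_pi // big_cat. Qed.

Lemma tliftZ c t : tlift f (tscale c t) = c *: tlift f t.
Proof.
rewrite tlift_pi // big_map /tlift scaler_sumr; apply: eq_bigr => p _ /=.
exact: (linZ (fb.2 p.2)).
Qed.

Lemma tliftN t : tlift f (topp t) = - tlift f t.
Proof. by rewrite tliftZ scaleN1r. Qed.

Lemma tliftE u v : tlift f (tens u v) = f u v.
Proof. by rewrite tlift_pi // big_seq1. Qed.
End Lift.

Fact taddA : associative tadd.
Proof.
by move=> s t r; apply: tensor_eqP => W f fb; rewrite !tliftD ?addrA.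
Qed.
Fact taddC : commutative tadd.
Proof.
by move=> s t; apply: tensor_eqP => W f fb; rewrite !tliftD // addrC.
Qed.
Fact tadd0 : left_id tzero tadd.
Proof.
by move=> t; apply: tensor_eqP => W f fb; rewrite tliftD // tlift0 // add0r.
Qed.
Fact taddN : left_inverse tzero topp tadd.
Proof.
move=> t; apply: tensor_eqP => W f fb.
by rewrite tliftD // tliftN // tlift0 // addNr.
Qed.
HB.instance Definition _ :=
  GRing.isZmodule.Build tensor taddA taddC tadd0 taddN.

Fact tscaleA a b t : tscale a (tscale b t) = tscale (a * b) t.
Proof. by apply: tensor_eqP => W f fb; rewrite !tliftZ // scalerA. Qed.
Fact tscale1 : left_id 1 tscale.
Proof. by move=> t; apply: tensor_eqP => W f fb; rewrite tliftZ // scale1r. Qed.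
Fact tscaleDr : right_distributive tscale +%R.
Proof.
move=> c s t; apply: tensor_eqP => W f fb.
by rewrite tliftZ // !tliftD // !tliftZ // scalerDr.
Qed.
Fact tscaleDl t : {morph tscale^~ t : a b / a + b}.
Proof.
move=> a b; apply: tensor_eqP => W f fb.
by rewrite tliftD // !tliftZ // scalerDl.
Qed.
HB.instance Definition _ := GRing.Zmodule_isLmodule.Build k tensor
  tscaleA tscale1 tscaleDr tscaleDl.

Lemma tens_bilinear : bilinear_map tens.
Proof.
split=> [u c x y|v c x y]; apply: tensor_eqP => W f fb.
  by rewrite tliftD // tliftZ // !tliftE // fb.1.
by rewrite tliftD // tliftZ // !tliftE // fb.2.
Qed.

Lemma tlift_linear (W : lmodType k) (f : U -> V -> W) :
  bilinear_map f -> linear (tlift f).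
Proof. by move=> fb c s t; rewrite tliftD // tliftZ. Qed.

Lemma tensorP (t : tensor) :
  exists s : seq (U * V), t = \sum_(p <- s) tens p.1 p.2.
Proof.
exists (repr t); apply: tensor_eqP => W f fb.
have fD x y : tlift f (x + y) = tlift f x + tlift f y by exact: tliftD.
rewrite {1}/tlift; elim/big_rec2: _ => [|p x y _ ->]; first by rewrite tlift0.
by rewrite fD tliftE.
Qed.

(* The image in U ⊗ V of the tensor product of two subspaces P and Q. *)
Definition in_tensor (P : U -> Prop) (Q : V -> Prop) (t : tensor) : Prop :=
  exists2 s : seq (U * V), (forall p, p \in s -> P p.1 /\ Q p.2) &
    t = \sum_(p <- s) tens p.1 p.2.
End Tensor.

Notation "u ⊗ v" := (tens u v) : ring_scope.
(* Sweedler notation: if t = sum_i u_i ⊗ v_i, this is sum_i E(u_i, v_i). *)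
Notation "\sw ( u , v <- t ) E" := (tlift (fun u v => E) t) : ring_scope.

Record hopfData (k : fieldType) := HopfData {
  hopf_alg :> algType k;
  comul : hopf_alg -> tensor hopf_alg hopf_alg;
  counit : hopf_alg -> k;
  antipode : hopf_alg -> hopf_alg }.

Record is_hopf (k : fieldType) (H : hopfData k) : Prop := IsHopf {
  comul_linear : linear (@comul k H);
  counit_linear : linear (@counit k H : H -> k^o);
  antipode_linear : linear (@antipode k H);
  comul_coassoc : forall h : H,
    \sw (u, v <- comul h) \sw (u1, u2 <- comul u) (u1 ⊗ (u2 ⊗ v)) =
    \sw (u, v <- comul h) (u ⊗ comul v);
  comul_counitl : forall h : H, \sw (u, v <- comul h) (counit u *: v) = h;
  comul_counitr : forall h : H, \sw (u, v <- comul h) (counit v *: u) = h;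
  comul1 : comul (1 : H) = 1 ⊗ 1;
  comulM : forall h g : H, comul (h * g) =
    \sw (h1, h2 <- comul h) \sw (g1, g2 <- comul g) ((h1 * g1) ⊗ (h2 * g2));
  counit1 : counit (1 : H) = 1;
  counitM : forall h g : H, counit (h * g) = counit h * counit g;
  antipodel : forall h : H,
    \sw (u, v <- comul h) (antipode u * v) = counit h *: 1;
  antipoder : forall h : H,
    \sw (u, v <- comul h) (u * antipode v) = counit h *: 1 }.

Record ydData (k : fieldType) (H : hopfData k) := YDData {
  yd_mod :> lmodType k;
  act : H -> yd_mod -> yd_mod;
  coact : yd_mod -> tensor H yd_mod }.

Record is_yd (k : fieldType) (H : hopfData k) (M : ydData H) : Prop := IsYD {
  act_bilinear : bilinear_map (@act k H M);
  act1 : forall m : M, act 1 m = m;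
  actM : forall (h g : H) (m : M), act (h * g) m = act h (act g m);
  coact_linear : linear (@coact k H M);
  coact_coassoc : forall m : M,
    \sw (h, n <- coact m) \sw (h1, h2 <- comul h) (h1 ⊗ (h2 ⊗ n)) =
    \sw (h, n <- coact m) (h ⊗ coact n);
  coact_counit : forall m : M, \sw (h, n <- coact m) (counit h *: n) = m;
  yd_compat : forall (h : H) (m : M), coact (act h m) =
    \sw (h1, g <- comul h) \sw (h2, h3 <- comul g) \sw (l, n <- coact m)
      ((h1 * l * antipode h3) ⊗ act h2 n) }.

Definition yd_morphism (k : fieldType) (H : hopfData k) (M N : ydData H)
    (f : M -> N) : Prop :=
  [/\ linear f,
      forall (h : H) (m : M), f (act h m) = act h (f m) &
      forall m : M, coact (f m) = \sw (h, n <- coact m) (h ⊗ f n)].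

Definition yd_unit (k : fieldType) (H : hopfData k) : ydData H :=
  @YDData k H k^o (fun h c => counit h *: c) (fun c => 1 ⊗ c).

Definition yd_tensor (k : fieldType) (H : hopfData k) (M N : ydData H) :
    ydData H :=
  @YDData k H (tensor M N)
    (fun h t => \sw (h1, h2 <- comul h) \sw (m, n <- t) (act h1 m ⊗ act h2 n))
    (fun t => \sw (m, n <- t) \sw (h, m0 <- coact m) \sw (g, n0 <- coact n)
       ((h * g) ⊗ (m0 ⊗ n0))).

Definition braiding (k : fieldType) (H : hopfData k) (M N : ydData H)
    (t : tensor M N) : tensor N M :=
  \sw (m, n <- t) \sw (h, m0 <- coact m) (act h n ⊗ m0).

Record bhopfData (k : fieldType) (H : hopfData k) := BHopfData {
  bhopf_alg :> algType k;
  bact : H -> bhopf_alg -> bhopf_alg;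
  bcoact : bhopf_alg -> tensor H bhopf_alg;
  bcomul : bhopf_alg -> tensor bhopf_alg bhopf_alg;
  bcounit : bhopf_alg -> k;
  bantipode : bhopf_alg -> bhopf_alg }.

Definition yd_of_bhopf (k : fieldType) (H : hopfData k) (R : bhopfData H) :
  ydData H := YDData (@bact k H R) (@bcoact k H R).

(* The product of R ⊗ R twisted by the braiding. *)
Definition bmul (k : fieldType) (H : hopfData k) (R : bhopfData H)
    (s t : tensor R R) : tensor R R :=
  \sw (r1, r2 <- s) \sw (s1, s2 <- t)
    \sw (s1', r2' <- @braiding k H (yd_of_bhopf R) (yd_of_bhopf R) (r2 ⊗ s1))
      ((r1 * s1') ⊗ (r2' * s2)).

Record is_bhopf (k : fieldType) (H : hopfData k) (R : bhopfData H) : Prop :=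
  IsBHopf {
  bhopf_yd : is_yd (yd_of_bhopf R);
  bunit_morphism : @yd_morphism k H (yd_unit H) (yd_of_bhopf R)
    (fun c : k => c%:A : R);
  bmul_morphism : @yd_morphism k H
    (yd_tensor (yd_of_bhopf R) (yd_of_bhopf R)) (yd_of_bhopf R)
    (fun t : tensor R R => \sw (r, s <- t) (r * s));
  bcomul_morphism : @yd_morphism k H
    (yd_of_bhopf R) (yd_tensor (yd_of_bhopf R) (yd_of_bhopf R)) (@bcomul k H R);
  bcounit_morphism :
    @yd_morphism k H (yd_of_bhopf R) (yd_unit H) (@bcounit k H R);
  bantipode_morphism :
    @yd_morphism k H (yd_of_bhopf R) (yd_of_bhopf R) (@bantipode k H R);
  bcomul_coassoc : forall r : R,
    \sw (u, v <- bcomul r) \sw (u1, u2 <- bcomul u) (u1 ⊗ (u2 ⊗ v)) =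
    \sw (u, v <- bcomul r) (u ⊗ bcomul v);
  bcomul_counitl : forall r : R, \sw (u, v <- bcomul r) (bcounit u *: v) = r;
  bcomul_counitr : forall r : R, \sw (u, v <- bcomul r) (bcounit v *: u) = r;
  bcomul1 : bcomul (1 : R) = 1 ⊗ 1;
  bcomulM : forall r s : R, bcomul (r * s) = bmul (bcomul r) (bcomul s);
  bcounit1 : bcounit (1 : R) = 1;
  bcounitM : forall r s : R, bcounit (r * s) = bcounit r * bcounit s;
  bantipodel : forall r : R,
    \sw (u, v <- bcomul r) (bantipode u * v) = bcounit r *: 1;
  bantipoder : forall r : R,
    \sw (u, v <- bcomul r) (u * bantipode v) = bcounit r *: 1 }.

(* R is the internal direct sum of the subspaces G n, compatibly with its
   structure of braided Hopf algebra. *)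
Record is_grading (k : fieldType) (H : hopfData k) (R : bhopfData H)
    (G : nat -> R -> Prop) : Prop := IsGrading {
  grading0 : forall n, G n 0;
  gradingP : forall n c r s, G n r -> G n s -> G n (c *: r + s);
  grading_span : forall r : R, exists n (f : nat -> R),
    (forall i, G i (f i)) /\ r = \sum_(i < n) f i;
  grading_direct : forall n (f : nat -> R), (forall i, G i (f i)) ->
    \sum_(i < n) f i = 0 -> forall i, (i < n)%N -> f i = 0;
  grading_act : forall n (h : H) r, G n r -> G n (bact h r);
  grading_coact : forall n r, G n r ->
    in_tensor (fun=> True) (G n) (bcoact r);
  grading1 : G 0 1;
  gradingM : forall m n r s, G m r -> G n s -> G (m + n)%N (r * s);
  grading_comul : forall n r, G n r -> exists2 f : nat -> tensor R R,
    forall i, (i <= n)%N -> in_tensor (G i) (G (n - i)%N) (f i) &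
    bcomul r = \sum_(i < n.+1) f i;
  grading_counit : forall n r, (0 < n)%N -> G n r -> bcounit r = 0;
  grading_antipode : forall n r, G n r -> G n (bantipode r) }.

Definition primitive (k : fieldType) (H : hopfData k) (R : bhopfData H)
    (r : R) : Prop :=
  bcomul r = r ⊗ 1 + 1 ⊗ r.

Definition generated_by (k : fieldType) (A : algType k) (X : A -> Prop) :
    Prop :=
  forall P : A -> Prop, (forall r, X r -> P r) -> P 1 ->
    (forall c r s, P r -> P s -> P (c *: r + s)) ->
    (forall r s, P r -> P s -> P (r * s)) -> forall r, P r.

(* R, graded by G and with V identified to G 1 through iota, is the Nichols
   algebra of V. *)
Record is_nichols (k : fieldType) (H : hopfData k) (V : ydData H)
    (R : bhopfData H) (G : nat -> R -> Prop) (iota : V -> R) : Prop :=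
  IsNichols {
  nichols_bhopf : is_bhopf R;
  nichols_grading : is_grading G;
  nichols0 : forall r, G 0 r <-> exists c : k, r = c%:A;
  nichols1_morphism : @yd_morphism k H V (yd_of_bhopf R) iota;
  nichols1_inj : injective iota;
  nichols1_image : forall r, G 1 r <-> exists v, r = iota v;
  nichols_primitive : forall r : R, G 1 r <-> primitive r;
  nichols_generated : generated_by (G 1) }.

Notation freeAlg k n := {malg k[{fmonom 'I_n}]}.

Definition fgen (k : fieldType) (n : nat) (i : 'I_n) : freeAlg k n :=
  << fmu i >>.

(* The algebra morphism from the free algebra that sends fgen i to g i. *)
Definition feval (k : fieldType) (n : nat) (A : algType k) (g : 'I_n -> A) :
    freeAlg k n -> A :=
  mmap (GRing.in_alg A)
    (fun m : {fmonom 'I_n} => \prod_(i <- (m : seq 'I_n)) g i).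

Definition two_sided_ideal (k : fieldType) (n : nat) (rels : seq (freeAlg k n))
    (p : freeAlg k n) : Prop :=
  exists2 s : seq (freeAlg k n * freeAlg k n * freeAlg k n),
    (forall t, t \in s -> t.1.2 \in rels) &
    p = \sum_(t <- s) t.1.1 * t.1.2 * t.2.

(* A is the quotient of the free algebra by the two-sided ideal generated by
   rels, the class of fgen i being g i. *)
Definition presented (k : fieldType) (n : nat) (A : algType k) (g : 'I_n -> A)
    (rels : seq (freeAlg k n)) : Prop :=
  (forall r : A, exists p, r = feval g p) /\
  (forall p, feval g p = 0 <-> two_sided_ideal rels p).

Definition is_basis (k : fieldType) (M : lmodType k) (n : nat)
    (e : 'I_n -> M) : Prop :=
  bijective (fun c : 'rV[k]_n => \sum_i c 0 i *: e i).

Definition has_dim (k : fieldType) (M : lmodType k) (n : nat) : Prop :=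
  exists e : 'I_n -> M, is_basis e.

Definition calK_rels (k : fieldType) (xi : k) : seq (freeAlg k 4) :=
  let a := fgen k (0 : 'I_4) in let b := fgen k (1 : 'I_4) in
  let c := fgen k (2 : 'I_4) in let d := fgen k (3 : 'I_4) in
  [:: a * b - xi *: (b * a); a * c - xi *: (c * a); c * b; b * c;
      c * d - xi *: (d * c); b * d - xi *: (d * b); a * d - d * a; a * d - 1;
      b ^+ 2; c ^+ 2; a ^+ 2 * c - b; a ^+ 4 - 1].

Record is_calK (k : fieldType) (xi : k) (K : hopfData k) (a b c d : K) : Prop :=
  IsCalK {
  calK_hopf : is_hopf K;
  calK_presented :
    presented (fun i : 'I_4 => [:: a; b; c; d]`_i) (calK_rels xi);
  calK_comula : comul a = a ⊗ a + b ⊗ c;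
  calK_comulb : comul b = a ⊗ b + b ⊗ d;
  calK_comulc : comul c = c ⊗ a + d ⊗ c;
  calK_comuld : comul d = c ⊗ b + d ⊗ d;
  calK_counita : counit a = 1;
  calK_counitb : counit b = 0;
  calK_counitc : counit c = 0;
  calK_counitd : counit d = 1;
  calK_antipodea : antipode a = d;
  calK_antipodeb : antipode b = xi *: b;
  calK_antipodec : antipode c = - xi *: c;
  calK_antipoded : antipode d = a }.

(* The module V_{i,3}, with lam = xi ^+ i. *)
Record is_Vi3 (k : fieldType) (xi : k) (K : hopfData k) (a b c d : K)
    (lam : k) (V : ydData K) (e1 e2 : V) : Prop := IsVi3 {
  Vi3_yd : is_yd V;
  Vi3_basis : is_basis (fun j : 'I_2 => [:: e1; e2]`_j);
  Vi3_a1 : act a e1 = lam *: e1;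
  Vi3_b1 : act b e1 = 0;
  Vi3_c1 : act c e1 = 0;
  Vi3_d1 : act d e1 = lam^-1 *: e1;
  Vi3_a2 : act a e2 = - (xi * lam) *: e2;
  Vi3_b2 : act b e2 = lam ^+ 2 *: e1;
  Vi3_c2 : act c e2 = e1;
  Vi3_d2 : act d e2 = (xi * lam^-1) *: e2;
  Vi3_coact1 : coact e1 = a ⊗ e1 + (lam ^+ 3 + xi * lam) *: (b ⊗ e2);
  Vi3_coact2 :
    coact e2 = d ⊗ e2 + (2%:R^-1 * (lam - xi * lam ^+ 3)) *: (c ⊗ e1) }.

Definition nichols_rels (k : fieldType) : seq (freeAlg k 2) :=
  let x := fgen k (0 : 'I_2) in let y := fgen k (1 : 'I_2) in
  [:: x ^+ 2 - 2%:R *: y ^+ 2; x * y + y * x; y ^+ 4].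

(* Main.v *)
Require Import Defs.
From mathcomp Require Import all_boot all_order all_algebra ring.
From mathcomp Require Import boolp monalg.

(** Write x = e1, y = e2, kappa = (1 - xi) / 2.  In degree one the braiding is
    c(x ⊗ x) = - xi x ⊗ x,           c(x ⊗ y) = - y ⊗ x - (1 + xi) x ⊗ y,
    c(y ⊗ x) = xi x ⊗ y,             c(y ⊗ y) = - y ⊗ y + kappa x ⊗ x.

    The three relations hold in any Nichols algebra R of V because the
    primitive elements of R all have degree one: an element that is both
    primitive and homogeneous of degree other than one is zero
    ([primitive_homog0]).  Since x and y are primitive, the product formula for
    the coproduct reduces to a rule for the coproduct of x s and of y s
    ([bcomul_iotaM]), and applying it repeatedly shows that x y + y x and
    x^2 - 2 y^2 are primitive, and then, modulo these two relations, that y^4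
    is primitive ([anticomm], [x_sqr], [y_pow4]).

    Modulo the relations, every element of the free algebra on x and y reduces
    to a combination of the eight monomials x^i y^j with i < 2 and j < 4
    ([normal_form]).  So both the presentation and the dimension follow
    once these monomials are linearly independent in R
    ([presented_of_monomials]).

    For the independence, a linear form f on V, extended by zero to the other
    degrees of R, gives an operator r |-> f(r_(1)) r_(2) on R.  The operators
    dx and dy obtained from the coordinates of V kill 1 and satisfy
    dx (x s) = s - xi x dx s - (1 + xi) y dy s,   dy (x s) = - x dy s,
    dx (y s) = xi y dx s + kappa x dy s,          dy (y s) = s - y dy s
    ([skew_derivations]).  They lower the degree by one, and dx dx dx dy sends
    the top monomial x y^3 to xi kappa, which is nonzero; applying the same
    operators step by step to a linear relation between the monomials makes
    all its coefficients vanish ([monomials_free]). *)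

Set Implicit Arguments.
Unset Strict Implicit.
Unset Printing Implicit Defensive.

Import GRing.Theory.
Local Open Scope ring_scope.

(** * Linear maps and tensors *)

Section Linear.
Variable k : fieldType.
Implicit Types U V W X : lmodType k.

Section One.
Variables (U W : lmodType k) (g : U -> W).
Hypothesis gl : linear g.

Lemma linD u v : g (u + v) = g u + g v.
Proof. by have := gl 1 u v; rewrite !scale1r. Qed.

Lemma linN u : g (- u) = - g u.
Proof. by rewrite -!scaleN1r (linZ gl). Qed.

Lemma linB u v : g (u - v) = g u - g v.
Proof. by rewrite linD linN. Qed.

Lemma lin_sum I (r : seq I) (P : pred I) F :
  g (\sum_(i <- r | P i) F i) = \sum_(i <- r | P i) g (F i).
Proof. exact: (big_morph g linD (lin0 gl)). Qed.
End One.

Lemma linear_comp U V W (g : V -> W) (h : U -> V) :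
  linear g -> linear h -> linear (fun u => g (h u)).
Proof. by move=> gl hl c u v; rewrite hl gl. Qed.

Lemma linear_add U W (g h : U -> W) :
  linear g -> linear h -> linear (fun u => g u + h u).
Proof. by move=> gl hl c u v; rewrite gl hl scalerDr addrACA. Qed.

Lemma linear_scale U W (c : k) (g : U -> W) :
  linear g -> linear (fun u => c *: g u).
Proof. by move=> gl e u v; rewrite gl scalerDr !scalerA mulrC. Qed.

Lemma bilinear_comp U V U' V' W (B : U' -> V' -> W) (g : U -> U') (h : V -> V') :
  bilinear_map B -> linear g -> linear h ->
  bilinear_map (fun u v => B (g u) (h v)).
Proof.
move=> [Br Bl] gl hl; split=> [u|v]; first exact: linear_comp (Br _) hl.
exact: linear_comp (Bl _) gl.
Qed.

Lemma bilinear_add U V W (f g : U -> V -> W) :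
  bilinear_map f -> bilinear_map g -> bilinear_map (fun u v => f u v + g u v).
Proof.
move=> [fr fl] [gr gl].
by split=> [u|v]; [apply: linear_add (fr u) (gr u)|apply: linear_add (fl v) (gl v)].
Qed.

Lemma bilinear_scale U V W (c : k) (f : U -> V -> W) :
  bilinear_map f -> bilinear_map (fun u v => c *: f u v).
Proof.
by move=> [fr fl]; split=> [u|v]; [apply: linear_scale (fr u)|apply: linear_scale (fl v)].
Qed.

Lemma scale_bilinear U V (f : U -> k) :
  linear (f : U -> k^o) -> bilinear_map (fun (u : U) (v : V) => f u *: v).
Proof.
move=> fl; split=> [u|v] c p q.
  by rewrite scalerDr !scalerA mulrC.
by rewrite fl scalerDl scalerA.
Qed.

Lemma tlift_fun_linear U V W X (f : X -> U -> V -> W) t :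
  (forall u v, linear (fun x => f x u v)) -> linear (fun x => tlift (f x) t).
Proof.
move=> fl c x x'; rewrite /tlift scaler_sumr -big_split.
by apply: eq_bigr => p _; rewrite fl.
Qed.

Lemma eq_tlift U V W (f g : U -> V -> W) t :
  (forall u v, f u v = g u v) -> tlift f t = tlift g t.
Proof. by move=> e; apply: eq_bigr => p _. Qed.

Lemma tlift_addf U V W (f g : U -> V -> W) t :
  tlift (fun u v => f u v + g u v) t = tlift f t + tlift g t.
Proof. exact: big_split. Qed.

(** [tlift f t] is a finite sum, over a representative of t. *)
Lemma lin_tlift U V W X (F : W -> X) (f : U -> V -> W) t :
  linear F -> F (tlift f t) = tlift (fun u v => F (f u v)) t.
Proof. by move=> Fl; rewrite /tlift (lin_sum Fl). Qed.

Lemma tlift_scalef U V W c (f : U -> V -> W) t :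
  tlift (fun u v => c *: f u v) t = c *: tlift f t.
Proof. by rewrite (lin_tlift _ _ (F := fun w => c *: w)) //; apply: linear_scale. Qed.

Lemma tlift2E U V W (f : U -> V -> W) c u v u' v' :
  bilinear_map f -> tlift f (u ⊗ v + c *: (u' ⊗ v')) = f u v + c *: f u' v'.
Proof.
by move=> fb; rewrite (linD (tlift_linear fb)) (linZ (tlift_linear fb)) !tliftE.
Qed.

End Linear.

Section LeftMul.
Variables (k : fieldType) (A : algType k).

Lemma mull_linear (r : A) : linear (fun s : A => r * s).
Proof. by move=> c u v; rewrite mulrDr scalerAr. Qed.

Lemma mulr_linear (r : A) : linear (fun s : A => s * r).
Proof. by move=> c u v; rewrite mulrDl scalerAl. Qed.

Lemma mul_bilinear : bilinear_map (fun r s : A => r * s).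
Proof. by split=> r; [apply: mull_linear|apply: mulr_linear]. Qed.
End LeftMul.

Section TensLinear.
Variables (k : fieldType) (U V : lmodType k).
Implicit Types (u : U) (v : V).
Let tl v : linear (fun u => u ⊗ v) := (tens_bilinear U V).2 v.
Let tr u : linear (fun v => u ⊗ v) := (tens_bilinear U V).1 u.

Lemma tensDl u u' v : (u + u') ⊗ v = u ⊗ v + u' ⊗ v.
Proof. exact: (linD (tl v)). Qed.

Lemma tensDr u v v' : u ⊗ (v + v') = u ⊗ v + u ⊗ v'.
Proof. exact: (linD (tr u)). Qed.

Lemma tensNl u v : (- u) ⊗ v = - (u ⊗ v).
Proof. exact: (linN (tl v)). Qed.

Lemma tensNr u v : u ⊗ (- v) = - (u ⊗ v).
Proof. exact: (linN (tr u)). Qed.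

Lemma tensZl c u v : (c *: u) ⊗ v = c *: (u ⊗ v).
Proof. exact: (linZ (tl v)). Qed.

Lemma tensZr c u v : u ⊗ (c *: v) = c *: (u ⊗ v).
Proof. exact: (linZ (tr u)). Qed.

Lemma tens0l v : 0 ⊗ v = 0 :> tensor U V.
Proof. exact: (lin0 (tl v)). Qed.

Lemma tens0r u : u ⊗ 0 = 0 :> tensor U V.
Proof. exact: (lin0 (tr u)). Qed.

Definition tensE :=
  (tensDl, tensDr, tensNl, tensNr, tensZl, tensZr, tens0l, tens0r).
End TensLinear.

Lemma basis_coord (k : fieldType) (M : lmodType k) n (e : 'I_n -> M) :
  is_basis e -> exists f : 'I_n -> M -> k,
  [/\ forall i, linear (f i : M -> k^o), forall i j, f i (e j) = (i == j)%:R &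
      forall v, v = \sum_i f i v *: e i].
Proof.
move=> [h hK1 hK2]; exists (fun i v => h v 0 i); split.
- move=> i c u v; suff -> : h (c *: u + v) = c *: h u + h v by rewrite !mxE.
  apply: (can_inj hK1); rewrite hK2 -{1}[u]hK2 -{1}[v]hK2 scaler_sumr -big_split.
  by apply: eq_bigr => j _; rewrite !mxE scalerDl scalerA.
- move=> i j; suff -> : h (e j) = delta_mx 0 j by rewrite mxE eqxx.
  apply: (can_inj hK1); rewrite hK2 (bigD1 j) //= mxE !eqxx scale1r.
  by rewrite big1 ?addr0 // => l /negPf ne; rewrite mxE ne andbF scale0r.
- by move=> v; rewrite hK2.
Qed.

(** * Equality of linear combinations *)

Section LinearCombinations.
Variables (k : fieldType) (V : lmodType k).

(** Formal linear combinations, whose atoms are positions in a list of vectors. *)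
Inductive lexp :=
  | LAtom of nat
  | LZero
  | LAdd of lexp & lexp
  | LOpp of lexp
  | LScale of k & lexp.

Fixpoint leval (v : seq V) (e : lexp) : V :=
  match e with
  | LAtom i => v`_i
  | LZero => 0
  | LAdd e1 e2 => leval v e1 + leval v e2
  | LOpp e1 => - leval v e1
  | LScale c e1 => c *: leval v e1
  end.

Fixpoint lcoef (e : lexp) (i : nat) : k :=
  match e with
  | LAtom j => (j == i)%:R
  | LZero => 0
  | LAdd e1 e2 => lcoef e1 i + lcoef e2 i
  | LOpp e1 => - lcoef e1 i
  | LScale c e1 => c * lcoef e1 i
  end.

Fixpoint lcoef_eq (n : nat) (e1 e2 : lexp) : Prop :=
  if n is m.+1 then lcoef e1 m = lcoef e2 m /\ lcoef_eq m e1 e2 else True.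

Lemma levalE v e : leval v e = \sum_(i < size v) lcoef e i *: v`_i.
Proof.
elim: e => [j||e1 IH1 e2 IH2|e IH|c e IH] /=.
- have [lt_j|ge_j] := ltnP j (size v).
    rewrite (bigD1 (Ordinal lt_j)) //= eqxx scale1r big1 ?addr0 // => i ne_i.
    by rewrite -val_eqE /= in ne_i; rewrite eq_sym (negPf ne_i) scale0r.
  rewrite nth_default // big1 // => i _; case: eqP => [ji|_].
    by move: (ltn_ord i); rewrite -ji ltnNge ge_j.
  by rewrite scale0r.
- by rewrite big1 // => i _; rewrite scale0r.
- by rewrite IH1 IH2 -big_split; apply: eq_bigr => i _; rewrite scalerDl.
- by rewrite IH -sumrN; apply: eq_bigr => i _; rewrite scaleNr.
- by rewrite IH scaler_sumr; apply: eq_bigr => i _; rewrite scalerA.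
Qed.

Lemma leval_eq v e1 e2 : lcoef_eq (size v) e1 e2 -> leval v e1 = leval v e2.
Proof.
rewrite !levalE; elim: (size v) => [|n IH] /=; first by rewrite !big_ord0.
by move=> [en /IH e]; rewrite !big_ord_recr /= e en.
Qed.
End LinearCombinations.

(* Atoms are compared up to unification, since the same tensor may carry its
   module structure along different inheritance paths. *)
Ltac lmod_same s t := match goal with _ => unify s t end.

Ltac lmod_atoms v t :=
  lazymatch t with
  | ?a + ?b => let v1 := lmod_atoms v a in lmod_atoms v1 b
  | - ?a => lmod_atoms v a
  | _ *: ?a => lmod_atoms v a
  | 0 => v
  | _ => let rec add w :=
           match w with
           | ?s :: _ => let _ := lmod_same s t in v
           | _ :: ?w' => add w'
           | nil => constr:(t :: v)
           end in add v
  end.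

Ltac lmod_reify k v t :=
  lazymatch t with
  | ?a + ?b =>
    let e1 := lmod_reify k v a in let e2 := lmod_reify k v b in
    constr:(LAdd e1 e2)
  | - ?a => let e := lmod_reify k v a in constr:(LOpp e)
  | ?c *: ?a => let e := lmod_reify k v a in constr:(LScale c e)
  | 0 => constr:(LZero k)
  | _ => let rec find w i :=
           match w with
           | ?s :: _ => let _ := lmod_same s t in constr:(LAtom k i)
           | _ :: ?w' => find w' (S i)
           end in find v 0%N
  end.

(** Reduces an equality of linear combinations over k to one equation in k for
    each vector that occurs in it. *)
Ltac lmod k :=
  lazymatch goal with
  | |- @eq ?T ?l ?r =>
    let v := lmod_atoms (@nil T) l in let v := lmod_atoms v r in
    let e1 := lmod_reify k v l in let e2 := lmod_reify k v r in
    refine (@leval_eq k _ v e1 e2 _); rewrite /=; do ![split]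
  end.

(** * Free algebras and presentations *)

Section FreeAlgebra.
Variables (k : fieldType) (n : nat).

Section Eval.
Variables (A : algType k) (g : 'I_n -> A).

Lemma fevalU c m : feval g << c *g m >> = c *: \prod_(i <- (m : seq 'I_n)) g i.
Proof. by rewrite /feval mmapU /= mulr_algl. Qed.

Lemma feval_gen i : feval g (fgen k i) = g i.
Proof. by rewrite fevalU scale1r fmU big_seq1. Qed.

Lemma feval1 : feval g 1 = 1.
Proof. by rewrite fevalU scale1r fm1 big_nil. Qed.

Lemma feval_sum I (r : seq I) (F : I -> freeAlg k n) :
  feval g (\sum_(i <- r) F i) = \sum_(i <- r) feval g (F i).
Proof. exact: raddf_sum. Qed.

Lemma fevalM p q : feval g (p * q) = feval g p * feval g q.
Proof.
rewrite malgME [feval g p]mmapE mulr_suml feval_sum /=; apply: eq_bigr => i _.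
rewrite [feval g q]mmapE mulr_sumr feval_sum /=; apply: eq_bigr => j _.
by rewrite fevalU fmM big_cat /= !mulr_algl -scalerAr -scalerAl scalerA mulrC.
Qed.

Lemma feval_linear : linear (feval g).
Proof.
move=> c p q; rewrite [LHS]mmapD; congr (_ + _).
by rewrite -/(feval g (c *: p)) -mul_malgC fevalM fevalU fm1 big_nil mulr_algl.
Qed.
End Eval.

Lemma freeAlg_ind (P : freeAlg k n -> Prop) :
  P 0 -> P 1 -> (forall c p q, P p -> P q -> P (c *: p + q)) ->
  (forall i p, P p -> P (fgen k i * p)) -> forall p, P p.
Proof.
move=> P0 P1 PL Pg p; rewrite [p]monalgE.
elim/big_rec: _ => [//|m q _ Pq].
have -> : << p@_m *g m >> = p@_m *: << m >> :> freeAlg k n.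
  by rewrite -mul_malgC malgM_def fgmulUU mulr1 mul1m.
apply: PL => // {p q Pq}; case: m => s.
elim: s => [|i s IH].
  suff <- : (1 : freeAlg k n) = << FMonom [::] >> by [].
  by congr << _ >>; rewrite /mone /one /= fmoneE.
suff -> : << FMonom (i :: s) >> = fgen k i * << FMonom s >> by apply: Pg.
by rewrite malgM_def fgmulUU mulr1 /mmul /mul /= fmuE fmmulE.
Qed.

Section Ideal.
Variable rels : seq (freeAlg k n).
Local Notation I := (two_sided_ideal rels).

Lemma ideal0 : I 0.
Proof. by exists [::]; rewrite ?big_nil. Qed.

Lemma ideal_gen p : p \in rels -> I p.
Proof.
move=> pr; exists [:: (1, p, 1)]; last by rewrite big_seq1 mul1r mulr1.
by move=> t; rewrite inE => /eqP ->.
Qed.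

Lemma ideal_lin c p q : I p -> I q -> I (c *: p + q).
Proof.
move=> [s sr ->] [t tr ->].
exists ([seq (c *: u.1.1, u.1.2, u.2) | u <- s] ++ t).
  by move=> u; rewrite mem_cat => /orP [/mapP [v vs ->]|/tr//]; exact: (sr v).
rewrite big_cat big_map scaler_sumr; congr (_ + _).
by apply: eq_bigr => u _; rewrite !scalerAl.
Qed.

Lemma ideal_mull r p : I p -> I (r * p).
Proof.
move=> [s sr ->]; exists [seq (r * u.1.1, u.1.2, u.2) | u <- s].
  by move=> u /mapP [v vs ->]; exact: (sr v).
by rewrite big_map mulr_sumr; apply: eq_bigr => u _; rewrite !mulrA.
Qed.

Lemma ideal_mulr r p : I p -> I (p * r).
Proof.
move=> [s sr ->]; exists [seq (u.1.1, u.1.2, u.2 * r) | u <- s].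
  by move=> u /mapP [v vs ->]; exact: (sr v).
by rewrite big_map mulr_suml; apply: eq_bigr => u _; exact: esym (mulrA _ _ _).
Qed.
End Ideal.

(** Elements N that span the quotient and are free in A turn the surjection from
    the quotient to A into an isomorphism. *)
Lemma presented_of_monomials (A : algType k) (g : 'I_n -> A)
    (rels : seq (freeAlg k n)) (m : nat) (N : 'I_m -> freeAlg k n) :
  generated_by (fun r => exists i, r = g i) ->
  (forall p, p \in rels -> feval g p = 0) ->
  (forall p, exists c : 'I_m -> k,
     two_sided_ideal rels (p - \sum_i c i *: N i)) ->
  (forall c : 'I_m -> k, \sum_i c i *: feval g (N i) = 0 ->
     forall i, c i = 0) ->
  presented g rels /\ has_dim A m.
Proof.
move=> gen rels0 span free.
have ideal0 p : two_sided_ideal rels p -> feval g p = 0.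
  move=> [s sr ->]; rewrite feval_sum big_seq big1 // => t /sr tr.
  by rewrite !fevalM (rels0 _ tr) mulr0 mul0r.
have eval_comb (c : 'I_m -> k) :
    feval g (\sum_i c i *: N i) = \sum_i c i *: feval g (N i).
  by rewrite feval_sum; apply: eq_bigr => i _; rewrite (linZ (feval_linear g)).
have evalE p : exists c : 'I_m -> k,
    two_sided_ideal rels (p - \sum_i c i *: N i) /\
    feval g p = \sum_i c i *: feval g (N i).
  have [c cI] := span p; exists c; split=> //.
  apply/eqP; rewrite -eval_comb -subr_eq0 -(linB (feval_linear g)).
  by rewrite ideal0.
have surj r : exists p, r = feval g p.
  apply: (gen (fun r => exists p, r = feval g p)) r
    => [r [i ->]||c r s [p ->] [q ->]|r s [p ->] [q ->]].
  - by exists (fgen k i); rewrite feval_gen.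
  - by exists 1; rewrite feval1.
  - by exists (c *: p + q); rewrite feval_linear.
  - by exists (p * q); rewrite fevalM.
split; first split=> // p.
  split=> [p0|]; last exact: ideal0.
  have [c [cI]] := evalE p; rewrite p0 => /esym /free c0.
  by move: cI; rewrite big1 ?subr0 // => i _; rewrite c0 scale0r.
exists (fun i => feval g (N i)).
have coord r : exists c : 'rV[k]_m, r = \sum_i c 0 i *: feval g (N i).
  have [p ->] := surj r; have [c [_ ->]] := evalE p.
  by exists (\row_i c i); apply: eq_bigr => i _; rewrite mxE.
have /choice [h hE] := coord.
exists h => [c|r]; last by rewrite -hE.
apply/rowP => i; apply/eqP; rewrite -subr_eq0; apply/eqP.
apply: (free (fun i => (h _) 0 i - c 0 i)).
rewrite (eq_bigr (fun i => (h (\sum_i c 0 i *: feval g (N i))) 0 i *: feval g (N i)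
   - c 0 i *: feval g (N i))); last by move=> j _; rewrite scalerBl.
by rewrite sumrB -hE subrr.
Qed.
End FreeAlgebra.

(** * Braided Hopf algebras *)

Section BraidedHopf.
Variables (k : fieldType) (H : hopfData k) (R : bhopfData H).
Hypothesis hR : is_bhopf R.

Lemma bact_bilinear : bilinear_map (@bact k H R).
Proof. exact: act_bilinear (bhopf_yd hR). Qed.

Lemma bactr_linear h : linear (@bact k H R h).
Proof. exact: bact_bilinear.1. Qed.

Lemma bact1r (r : R) : bact 1 r = r.
Proof. exact: act1 (bhopf_yd hR) r. Qed.

Lemma bcoact_linear : linear (@bcoact k H R).
Proof. exact: coact_linear (bhopf_yd hR). Qed.

Lemma bcomul_linear : linear (@bcomul k H R).
Proof. by case: (bcomul_morphism hR). Qed.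

Lemma bcounit_linear : linear (@bcounit k H R : R -> k^o).
Proof. by case: (bcounit_morphism hR). Qed.

Lemma bactr1 (h : H) : bact h (1 : R) = counit h *: 1.
Proof.
have [_ /(_ h 1) /= e _] := bunit_morphism hR; rewrite scale1r in e.
by rewrite -e; congr (_ *: _); rewrite [LHS]mulr1.
Qed.

Lemma bcoact1 : bcoact (1 : R) = 1 ⊗ 1.
Proof.
have [_ _ /(_ 1) /=] := bunit_morphism hR; rewrite !scale1r => ->.
rewrite tliftE ?scale1r //.
apply: (bilinear_comp (h := fun n : k^o => n *: (1 : R)) (tens_bilinear _ _)) => // c u v.
by rewrite scalerDl scalerA.
Qed.

Lemma bactM h (r s : R) :
  bact h (r * s) = \sw (h1, h2 <- comul h) (bact h1 r * bact h2 s).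
Proof.
have [ml /(_ h (r ⊗ s)) /= e _] := bmul_morphism hR.
have mb := mul_bilinear R.
have tE u v : tlift *%R (u ⊗ v) = u * v :> R by exact: tliftE.
move: e; rewrite tE => <-; rewrite (lin_tlift _ _ ml); apply: eq_tlift => h1 h2.
rewrite tliftE ?tE //.
by apply: bilinear_comp; [exact: tens_bilinear|exact: bactr_linear..].
Qed.

Lemma braiding_fun_bilinear (s : R) :
  bilinear_map (fun h r => bact h s ⊗ r : tensor R R).
Proof.
apply: (bilinear_comp (g := fun h : H => bact h s)) => //.
  exact: tens_bilinear.
exact: bact_bilinear.2.
Qed.

Lemma braidingE (r s : R) :
  @braiding k H (yd_of_bhopf R) (yd_of_bhopf R) (r ⊗ s) =
  \sw (h, r0 <- bcoact r) (bact h s ⊗ r0).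
Proof.
rewrite /braiding tliftE //; split=> [r'|s'].
  apply: tlift_fun_linear => h r0.
  apply: (linear_comp (g := fun s' => s' ⊗ r0)); last exact: bactr_linear.
  exact: (tens_bilinear _ _).2.
apply: (linear_comp (g := tlift _)); last exact: bcoact_linear.
exact/tlift_linear/braiding_fun_bilinear.
Qed.

Lemma braiding_linearl (s : R) : linear (fun r : R =>
  @braiding k H (yd_of_bhopf R) (yd_of_bhopf R) (r ⊗ s)).
Proof.
move=> c u v; rewrite !braidingE bcoact_linear.
exact: (tlift_linear (braiding_fun_bilinear s)).
Qed.

(** With bcomul r = r ⊗ 1 + 1 ⊗ r, the twisted product only has to move r past
    the first tensorand of [bcomul s]. *)
Lemma bcomulM_primitive (r s : R) : primitive r ->
  bcomul (r * s) =
  \sw (s1, s2 <- bcomul s)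
    ((r * s1) ⊗ s2 + \sw (h, r0 <- bcoact r) (bact h s1 ⊗ (r0 * s2))).
Proof.
move=> rP; rewrite (bcomulM hR) rP /bmul.
have inb r1 s2 : bilinear_map (fun s1' r2' : R => (r1 * s1') ⊗ (r2' * s2)).
  apply: (bilinear_comp (g := fun u => r1 * u) (h := fun u => u * s2)).
  - exact: tens_bilinear.
  - exact: mull_linear.
  - exact: mulr_linear.
set F := fun r1 r2 : R => _.
have Fb : bilinear_map F.
  split=> [r1|r2]; apply: tlift_fun_linear => s1 s2.
    apply: (linear_comp (g := tlift _)); first exact/tlift_linear/inb.
    exact: braiding_linearl.
  apply: tlift_fun_linear => s1' r2'.
  apply: (linear_comp (g := fun u => u ⊗ (r2' * s2))).
    exact: (tens_bilinear _ _).2.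
  exact: mulr_linear.
rewrite (linD (tlift_linear Fb)) !tliftE // tlift_addf.
congr (_ + _); apply: eq_tlift => s1 s2; rewrite braidingE.
  rewrite bcoact1 (tliftE (braiding_fun_bilinear s1)) (tliftE (inb r s2)) mul1r.
  by rewrite bact1r.
rewrite (lin_tlift _ _ (tlift_linear (inb 1 s2))).
by apply: eq_tlift => h r0; rewrite tliftE ?mul1r.
Qed.

End BraidedHopf.

(** * Degree-one components and skew derivations in a Nichols algebra *)

Section Nichols.
Variables (k : fieldType) (H : hopfData k) (V : ydData H).
Variables (R : bhopfData H) (G : nat -> R -> Prop) (iota : V -> R).
Hypothesis hR : is_nichols G iota.

Let hB := nichols_bhopf hR.
Let hG := nichols_grading hR.

Lemma iota_linear : linear iota.
Proof. by case: (nichols1_morphism hR). Qed.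

Lemma iota_act h v : iota (act h v) = bact h (iota v).
Proof. by case: (nichols1_morphism hR). Qed.

Lemma iota_coact v :
  bcoact (iota v) = \sw (h, n <- coact v) (h ⊗ iota n).
Proof. by case: (nichols1_morphism hR) => _ _; apply. Qed.

Lemma iota_deg1 v : G 1 (iota v).
Proof. by apply/(nichols1_image hR); exists v. Qed.

(** Asking all long enough partial sums to be r, rather than one of them, makes
    decompositions of different lengths addable without padding. *)
Definition decomposes (r : R) (f : nat -> R) : Prop :=
  (forall i, G i (f i)) /\
  exists N, forall n, (N <= n)%N -> r = \sum_(i < n) f i.

Lemma decomposes_exists r : exists f, decomposes r f.
Proof.
have [n [f [fG ->]]] := grading_span hG r.
exists (fun i => if (i < n)%N then f i else 0); split=> [i|].
  by case: ifP => // _; apply: grading0 hG i.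
by exists n => m le_nm; rewrite (big_ord_widen m f le_nm) big_mkcond.
Qed.

Lemma decomposes_lin c r s f g : decomposes r f -> decomposes s g ->
  decomposes (c *: r + s) (fun i => c *: f i + g i).
Proof.
move=> [fG [N rE]] [gG [M sE]]; split=> [i|].
  exact: (gradingP hG).
exists (N + M)%N => n le_n; rewrite big_split -scaler_sumr.
by rewrite -rE -?sE //; apply: leq_trans le_n; rewrite ?leq_addl ?leq_addr.
Qed.

Lemma decomposes_unique r f g : decomposes r f -> decomposes r g -> f =1 g.
Proof.
move=> rf rg i; apply/eqP; rewrite -subr_eq0 addrC -scaleN1r; apply/eqP.
have [dG [N d0]] := decomposes_lin (-1) rg rf.
apply: (grading_direct hG (n := (N + i.+1)%N) dG).
  by rewrite -d0 ?leq_addr // scaleN1r addNr.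
by rewrite addnS ltnS leq_addl.
Qed.

Lemma decomposes_homog n r : G n r ->
  decomposes r (fun i => if i == n then r else 0).
Proof.
move=> rG; split=> [i|].
  by case: eqP => [->//|_]; apply: grading0 hG i.
exists n.+1 => m lt_nm; rewrite -big_mkcond /=.
by rewrite (big_pred1 (Ordinal lt_nm)).
Qed.

Lemma decomposes_act h r f :
  decomposes r f -> decomposes (bact h r) (fun i => bact h (f i)).
Proof.
move=> [fG [N rE]]; split=> [i|]; first exact: grading_act hG _ _ _ (fG i).
by exists N => n /rE ->; rewrite (lin_sum (bactr_linear hB h)).
Qed.

Lemma decomposes_deg1M v r f : decomposes r f ->
  decomposes (iota v * r) (fun i => if i is j.+1 then iota v * f j else 0).
Proof.
move=> [fG [N rE]]; split=> [[|i]|]; first exact: grading0 hG 0%N.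
  by apply: (gradingM hG (m := 1)); first exact: iota_deg1.
exists N.+1 => [[//|n]] le_n; rewrite big_ord_recl add0r (rE n) //.
by rewrite mulr_sumr.
Qed.

Definition component (r : R) : nat -> R := sval (cid (decomposes_exists r)).

Lemma componentP r : decomposes r (component r).
Proof. exact: svalP (cid (decomposes_exists r)). Qed.

Lemma componentE r f : decomposes r f -> component r =1 f.
Proof. exact: decomposes_unique (componentP r). Qed.

Lemma component0 r : component r 0 = bcounit r *: 1.
Proof.
have [fG [N rE]] := componentP r.
have [c c0] : exists c : k, component r 0 = c%:A by apply/(nichols0 hR)/fG.
suff -> : bcounit r = c by [].
have eL := bcounit_linear hB.
rewrite (rE N.+1) // (lin_sum eL) big_ord_recl big1 => [|i _]; last first.
  exact: (grading_counit hG (n := i.+1)).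
by rewrite addr0 c0 (linZ eL) (bcounit1 hB) [LHS]mulr1.
Qed.

Lemma deg1_exists r : exists v, component r 1 = iota v.
Proof. by apply/(nichols1_image hR); case: (componentP r). Qed.

Definition deg1 (r : R) : V := sval (cid (deg1_exists r)).

Lemma deg1P r f v : decomposes r f -> f 1%N = iota v -> deg1 r = v.
Proof.
move=> rf f1; apply: (nichols1_inj hR).
by rewrite -(svalP (cid (deg1_exists r))) (componentE rf).
Qed.

Lemma iota_deg1E r : iota (deg1 r) = component r 1.
Proof. exact: esym (svalP (cid (deg1_exists r))). Qed.

Lemma deg1_linear : linear deg1.
Proof.
move=> c r s; apply: deg1P; first exact/decomposes_lin/componentP/componentP.
by rewrite iota_linear !iota_deg1E.
Qed.

Lemma deg1_1 : deg1 1 = 0.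
Proof.
apply: deg1P (decomposes_homog (grading1 hG)) _.
by rewrite (lin0 iota_linear).
Qed.

Lemma deg1_act h r : deg1 (bact h r) = act h (deg1 r).
Proof.
apply: deg1P (decomposes_act h (componentP r)) _.
by rewrite iota_act iota_deg1E.
Qed.

(** Only the degree-zero component of r contributes, and the counit computes
    it. *)
Lemma deg1_iotaM v r : deg1 (iota v * r) = bcounit r *: v.
Proof.
apply: deg1P (decomposes_deg1M v (componentP r)) _.
by rewrite component0 -scalerAr mulr1 (linZ iota_linear).
Qed.

(** The source of all relations in a Nichols algebra. *)
Lemma primitive_homog0 n r : n != 1%N -> G n r -> primitive r -> r = 0.
Proof.
move=> n1 rn /(nichols_primitive hR) r1.
have := decomposes_unique (decomposes_homog r1) (decomposes_homog rn) 1%N.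
by rewrite eqxx eq_sym (negPf n1).
Qed.

Lemma bcomul_iotaM v s : bcomul (iota v * s) =
  \sw (s1, s2 <- bcomul s)
    ((iota v * s1) ⊗ s2 +
     \sw (h, v0 <- coact v) (bact h s1 ⊗ (iota v0 * s2))).
Proof.
rewrite (bcomulM_primitive hB); last exact/(nichols_primitive hR)/iota_deg1.
apply: eq_tlift => s1 s2; congr (_ + _).
rewrite iota_coact.
have lb : bilinear_map (fun h r0 => bact h s1 ⊗ (r0 * s2) : tensor R R).
  apply: (bilinear_comp (g := fun h => bact h s1) (h := fun u => u * s2)).
  - exact: tens_bilinear.
  - exact: (bact_bilinear hB).2.
  - exact: mulr_linear.
rewrite (lin_tlift _ _ (tlift_linear lb)); apply: eq_tlift => h v0.
by rewrite tliftE.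
Qed.

Section SkewDerivation.
Variable f : V -> k.
Hypothesis fl : linear (f : V -> k^o).

(** The skew derivation attached to a linear form f on V: f is extended to R by
    zero outside degree one, and contracted with the coproduct. *)
Definition skew_der (r : R) : R := \sw (u, v <- bcomul r) (f (deg1 u) *: v).

Let pairing_bilinear :
  bilinear_map (fun u v : R => f (deg1 u) *: v).
Proof. by apply: scale_bilinear; apply: linear_comp fl deg1_linear. Qed.

Lemma skew_der_linear : linear skew_der.
Proof.
exact: linear_comp (tlift_linear pairing_bilinear) (bcomul_linear hB).
Qed.

Lemma skew_der1 : skew_der 1 = 0.
Proof.
by rewrite /skew_der (bcomul1 hB) tliftE // deg1_1 (lin0 fl) scale0r.
Qed.

(** The braided Leibniz rule. *)
Lemma skew_der_iotaM v s : skew_der (iota v * s) =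
  f v *: s +
  \sw (s1, s2 <- bcomul s)
    \sw (h, v0 <- coact v) (f (act h (deg1 s1)) *: (iota v0 * s2)).
Proof.
have pl := tlift_linear pairing_bilinear.
rewrite /skew_der bcomul_iotaM (lin_tlift _ _ pl).
rewrite -[in f v *: s](bcomul_counitl hB s).
rewrite -tlift_scalef -tlift_addf; apply: eq_tlift => s1 s2.
rewrite (linD pl) tliftE // deg1_iotaM (linZ fl) (lin_tlift _ _ pl); congr (_ + _).
  by rewrite scalerA mulrC.
by apply: eq_tlift => h v0; rewrite tliftE // deg1_act.
Qed.
End SkewDerivation.
End Nichols.

(** * The module V_{3,3} *)

(** The coefficient of c ⊗ e1 in the coaction of e2. *)
Definition kappa (k : fieldType) (xi : k) : k := 2%:R^-1 * (1 - xi).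

Section V33.
Variables (k : fieldType) (xi : k).
Hypotheses (two_neq0 : 2%:R != 0 :> k) (xi_root : 4.-primitive_root xi).
Variables (K : hopfData k) (a b c d : K).
Hypothesis hK : is_calK xi a b c d.
Variables (V : ydData K) (e1 e2 : V).
Hypothesis hV : is_Vi3 xi a b c d (xi ^+ 3) e1 e2.
Variables (R : bhopfData K) (G : nat -> R -> Prop) (iota : V -> R).
Hypothesis hR : is_nichols G iota.

Let hB := nichols_bhopf hR.
Let hG := nichols_grading hR.
Local Notation x := (iota e1).
Local Notation y := (iota e2).
Local Notation kap := (kappa xi).

Lemma xi_sqr : xi * xi = -1.
Proof.
have := prim_expr_order xi_root; rewrite (exprM xi 2 2) => /eqP.
rewrite sqrf_eq1 -(prim_order_dvd xi_root) /= => /eqP.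
by rewrite expr2.
Qed.

Lemma xi_cube : xi ^+ 3 = - xi.
Proof. by rewrite !exprS expr0; ring: xi_sqr. Qed.

Lemma xi_neq0 : xi != 0.
Proof.
apply/eqP => e; move/eqP: xi_sqr.
by rewrite e mul0r eq_sym oppr_eq0 oner_eq0.
Qed.

Lemma xi_cubeV : (xi ^+ 3)^-1 = xi.
Proof.
rewrite xi_cube; apply: (mulIf xi_neq0).
by rewrite invrN mulNr mulVf ?xi_neq0 // xi_sqr.
Qed.

Lemma kap_double : 2%:R * kap = 1 - xi.
Proof. by rewrite mulrA mulfV // mul1r. Qed.

Lemma kap_sqr : 2%:R * (kap * kap) = - xi.
Proof. by rewrite mulrA kap_double /kappa; field: xi_sqr. Qed.

Lemma act_a1 : act a e1 = - xi *: e1.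
Proof. by rewrite (Vi3_a1 hV) xi_cube. Qed.

Lemma act_d1 : act d e1 = xi *: e1.
Proof. by rewrite (Vi3_d1 hV) xi_cubeV. Qed.

Lemma act_a2 : act a e2 = - e2.
Proof.
by rewrite (Vi3_a2 hV) xi_cube -scaleN1r; congr (_ *: _); ring: xi_sqr.
Qed.

Lemma act_b2 : act b e2 = - e1.
Proof.
by rewrite (Vi3_b2 hV) xi_cube -scaleN1r; congr (_ *: _); ring: xi_sqr.
Qed.

Lemma act_d2 : act d e2 = - e2.
Proof. by rewrite (Vi3_d2 hV) xi_cubeV xi_sqr scaleN1r. Qed.

Lemma coact_e1 : coact e1 = a ⊗ e1 + (1 + xi) *: (b ⊗ e2).
Proof.
rewrite (Vi3_coact1 hV); congr (_ + _ *: _).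
(* (xi ^ 3) ^ 3 = xi ^ 9 = xi *)
rewrite -exprM (exprS xi 8) (exprM xi 4 2) (prim_expr_order xi_root) xi_cube.
by ring: xi_sqr.
Qed.

Lemma coact_e2 : coact e2 = d ⊗ e2 + kap *: (c ⊗ e1).
Proof.
rewrite (Vi3_coact2 hV); congr (_ + (_ * _) *: _).
(* (xi ^ 3) ^ 3 = xi ^ 9 = xi *)
rewrite -exprM (exprS xi 8) (exprM xi 4 2) (prim_expr_order xi_root) xi_cube.
by ring: xi_sqr.
Qed.

Definition actE :=
  (act_a1, Vi3_b1 hV, Vi3_c1 hV, act_d1, act_a2, act_b2, Vi3_c2 hV,
   act_d2).

Lemma bact_sw h g1 g2 g3 g4 (r s : R) : comul h = g1 ⊗ g2 + g3 ⊗ g4 ->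
  bact h (r * s) = bact g1 r * bact g2 s + bact g3 r * bact g4 s.
Proof.
move=> hE; rewrite (bactM hB) hE.
rewrite (linD (tlift_linear _)) ?tliftE //; apply: bilinear_comp => //.
all: try exact: mul_bilinear.
all: exact: (bact_bilinear hB).2.
Qed.

Let iL := iota_linear hR.
Definition iotaE := (linN iL, linZ iL, lin0 iL).

Lemma bact_mulx s :
  ((bact a (x * s)%R = - xi *: (x * bact a s)%R) *
   (bact b (x * s)%R = - xi *: (x * bact b s)%R) *
   (bact c (x * s)%R = xi *: (x * bact c s)%R) *
   (bact d (x * s)%R = xi *: (x * bact d s)%R))%type.
Proof.
rewrite (bact_sw _ _ (calK_comula hK)) (bact_sw _ _ (calK_comulb hK)).
rewrite (bact_sw _ _ (calK_comulc hK)) (bact_sw _ _ (calK_comuld hK)).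
by rewrite -!(iota_act hR) !actE !iotaE !mul0r !addr0 !add0r !scalerAl.
Qed.

Lemma bact_muly s :
  ((bact a (y * s)%R = - (y * bact a s)%R - (x * bact c s)%R) *
   (bact b (y * s)%R = - (y * bact b s)%R - (x * bact d s)%R) *
   (bact c (y * s)%R = (x * bact a s)%R - (y * bact c s)%R) *
   (bact d (y * s)%R = (x * bact b s)%R - (y * bact d s)%R))%type.
Proof.
rewrite (bact_sw _ _ (calK_comula hK)) (bact_sw _ _ (calK_comulb hK)).
rewrite (bact_sw _ _ (calK_comulc hK)) (bact_sw _ _ (calK_comuld hK)).
by rewrite -!(iota_act hR) !actE !iotaE !mulNr.
Qed.

Lemma bact_one :
  ((bact a (1 : R) = 1) * (bact b (1 : R) = 0) *
   (bact c (1 : R) = 0) * (bact d (1 : R) = 1))%type.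
Proof.
rewrite !(bactr1 hB) (calK_counita hK) (calK_counitb hK).
by rewrite (calK_counitc hK) (calK_counitd hK) !scale1r !scale0r.
Qed.

Lemma bact_gen :
  ((bact a x = - xi *: x) * (bact b x = 0) * (bact c x = 0) *
   (bact d x = xi *: x) * (bact a y = - y) * (bact b y = - x) *
   (bact c y = x) * (bact d y = - y))%type.
Proof. by rewrite -!(iota_act hR) !actE !iotaE. Qed.

Definition bactE := (bact_mulx, bact_muly, bact_one, bact_gen).

(** What left multiplication by x or y does to the coproduct, on pure
    tensors. *)
Definition comul_mulx (u v : R) : tensor R R :=
  (x * u) ⊗ v + (bact a u ⊗ (x * v) + (1 + xi) *: (bact b u ⊗ (y * v))).
Definition comul_muly (u v : R) : tensor R R :=
  (y * u) ⊗ v + (bact d u ⊗ (y * v) + kap *: (bact c u ⊗ (x * v))).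

Let bil_bact (h : K) (r : R) : bilinear_map (fun u v : R => bact h u ⊗ (r * v)).
Proof.
apply: (bilinear_comp (g := fun u => bact h u) (h := fun v => r * v)).
- exact: tens_bilinear.
- exact: bactr_linear hB h.
- exact: mull_linear.
Qed.

Let bil_mul (r : R) : bilinear_map (fun u v : R => (r * u) ⊗ v).
Proof.
apply: (bilinear_comp (g := fun u => r * u) (h := id)) => //.
- exact: tens_bilinear.
- exact: mull_linear.
Qed.

Let bil_coact (u v : R) :
  bilinear_map (fun (h : K) (v0 : V) => bact h u ⊗ (iota v0 * v)).
Proof.
apply: (bilinear_comp (g := fun h => bact h u) (h := fun v0 => iota v0 * v)).
- exact: tens_bilinear.
- exact: (bact_bilinear hB).2.
- exact: linear_comp (mulr_linear _) iL.
Qed.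

Lemma comul_mulx_bilinear : bilinear_map comul_mulx.
Proof. by apply/bilinear_add/bilinear_add => //; apply: bilinear_scale. Qed.

Lemma comul_muly_bilinear : bilinear_map comul_muly.
Proof. by apply/bilinear_add/bilinear_add => //; apply: bilinear_scale. Qed.

Lemma bcomul_mulx s : bcomul (x * s) = tlift comul_mulx (bcomul s).
Proof.
rewrite (bcomul_iotaM hR); apply: eq_tlift => u v; rewrite coact_e1.
by rewrite tlift2E.
Qed.

Lemma bcomul_muly s : bcomul (y * s) = tlift comul_muly (bcomul s).
Proof.
rewrite (bcomul_iotaM hR); apply: eq_tlift => u v; rewrite coact_e2.
by rewrite tlift2E.
Qed.

Lemma primitive_x : bcomul x = x ⊗ 1 + 1 ⊗ x.
Proof. exact/(nichols_primitive hR)/(iota_deg1 hR). Qed.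

Lemma primitive_y : bcomul y = y ⊗ 1 + 1 ⊗ y.
Proof. exact/(nichols_primitive hR)/(iota_deg1 hR). Qed.

Let tlx := tlift_linear comul_mulx_bilinear.
Let tly := tlift_linear comul_muly_bilinear.
Definition tlE := (linD tlx, linN tlx, linZ tlx, linD tly, linN tly, linZ tly,
  tliftE comul_mulx_bilinear, tliftE comul_muly_bilinear).

(** * The relations *)

Lemma deg2_iotaM v w : G 2 (iota v * iota w).
Proof. by apply: (gradingM hG (m := 1) (n := 1)); exact: (iota_deg1 hR). Qed.

Ltac expand_tens :=
  rewrite !(mulr1, mulr0, mulrN, mulrDr, bactE, =^~scalerAr, tensE).

Lemma anticomm : y * x = - (x * y).
Proof.
apply/eqP; rewrite -addr_eq0; apply/eqP.
apply: (primitive_homog0 hR (n := 2)) => //.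
  by rewrite -[y * x]scale1r; apply: (gradingP hG); apply: deg2_iotaM.
rewrite /primitive (linD (bcomul_linear hB)) bcomul_mulx bcomul_muly.
rewrite primitive_x primitive_y !tlE /comul_mulx /comul_muly.
expand_tens; lmod k; ring: xi_sqr.
Qed.

Lemma x_sqr : x * x = 2%:R *: (y * y).
Proof.
apply/eqP; rewrite -subr_eq0 addrC -scaleNr; apply/eqP.
apply: (primitive_homog0 hR (n := 2)) => //.
  by apply: (gradingP hG); apply: deg2_iotaM.
rewrite /primitive (bcomul_linear hB) bcomul_mulx bcomul_muly.
rewrite primitive_x primitive_y !tlE /comul_mulx /comul_muly.
by expand_tens; lmod k; rewrite /kappa; field: xi_sqr.
Qed.

Lemma anticommA u : y * (x * u) = - (x * (y * u)).
Proof. by rewrite mulrA anticomm mulNr -mulrA. Qed.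

Lemma x_sqrA u : x * (x * u) = 2%:R *: (y * (y * u)).
Proof. by rewrite mulrA x_sqr -scalerAl -mulrA. Qed.

(* Monomials are nested to the right; the quadratic relations move x to the
   left and leave at most one of them. *)
Ltac expand_tens_mod :=
  rewrite !(mulr1, mulr0, mulrN, mulrDr, bactE, =^~scalerAr, tensE,
            anticomm, anticommA, x_sqr, x_sqrA).

Lemma bcomul_y2 :
  bcomul (y * y) = (y * y) ⊗ 1 + 1 ⊗ (y * y) + kap *: (x ⊗ x).
Proof.
rewrite bcomul_muly primitive_y !tlE /comul_muly.
by expand_tens_mod; lmod k; ring.
Qed.

Lemma bcomul_y3 :
  bcomul (y * (y * y)) = (y * (y * y)) ⊗ 1 + 1 ⊗ (y * (y * y)) + y ⊗ (y * y) -
    (y * y) ⊗ y - kap *: ((x * y) ⊗ x) - (kap * xi) *: (x ⊗ (x * y)).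
Proof.
rewrite bcomul_muly bcomul_y2 !tlE /comul_muly.
by expand_tens_mod; lmod k; ring.
Qed.

(** The term in degree (2, 2) cancels because 4 xi kappa^2 = 2. *)
Lemma y_pow4 : y * (y * (y * y)) = 0.
Proof.
apply: (primitive_homog0 hR (n := 4)) => //.
  by rewrite mulrA; apply: (gradingM hG (m := 2) (n := 2)); apply: deg2_iotaM.
rewrite /primitive bcomul_muly bcomul_y3 !tlE /comul_muly.
by expand_tens_mod; lmod k; rewrite /kappa; field: xi_sqr.
Qed.

(** * Skew derivations of R *)

Let bil_der (f : V -> k) (w : V) (r : R) : linear (f : V -> k^o) ->
  bilinear_map (fun (h : K) v0 => f (act h w) *: (iota v0 * r)).
Proof.
move=> fl.
apply: (bilinear_comp (B := fun (c : k^o) s => c *: s : R)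
  (g := fun h : K => f (act h w) : k^o) (h := fun v0 => iota v0 * r)).
- exact: (@scale_bilinear k k^o R (fun c => c)).
- by apply: linear_comp fl _; apply: (act_bilinear (Vi3_yd hV)).2.
- exact: linear_comp (mulr_linear _) iL.
Qed.

Lemma skew_der_mulx (f : V -> k) s (fl : linear (f : V -> k^o)) :
  skew_der hR f (x * s) = f e1 *: s +
    (x * skew_der hR (fun v => f (act a v)) s +
     (1 + xi) *: (y * skew_der hR (fun v => f (act b v)) s)).
Proof.
rewrite (skew_der_iotaM hR fl) /skew_der; congr (_ + _).
rewrite !(lin_tlift _ _ (mull_linear _)) -tlift_scalef -tlift_addf.
apply: eq_tlift => u v.
by rewrite coact_e1 tlift2E -?scalerAr //; exact: bil_der.
Qed.

Lemma skew_der_muly (f : V -> k) s (fl : linear (f : V -> k^o)) :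
  skew_der hR f (y * s) = f e2 *: s +
    (y * skew_der hR (fun v => f (act d v)) s +
     kap *: (x * skew_der hR (fun v => f (act c v)) s)).
Proof.
rewrite (skew_der_iotaM hR fl) /skew_der; congr (_ + _).
rewrite !(lin_tlift _ _ (mull_linear _)) -tlift_scalef -tlift_addf.
apply: eq_tlift => u v.
by rewrite coact_e2 tlift2E -?scalerAr //; exact: bil_der.
Qed.

Lemma skew_derZ (f g : V -> k) t s : (forall v, g v = t * f v) ->
  skew_der hR g s = t *: skew_der hR f s.
Proof.
by move=> e; rewrite /skew_der -tlift_scalef; apply: eq_tlift => u v; rewrite e scalerA.
Qed.

(** The forms f (h . v), for f a coordinate of V and h one of a, b, c, d, are
    multiples of the coordinates, so the skew derivations of the two coordinates
    are closed under the Leibniz rules. *)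
Lemma skew_derivations : exists dx dy : R -> R,
  [/\ linear dx, linear dy, dx 1 = 0, dy 1 = 0 &
   [/\ forall s, dx (x * s) = s - xi *: (x * dx s) - (1 + xi) *: (y * dy s),
      forall s, dy (x * s) = - (x * dy s),
      forall s, dx (y * s) = xi *: (y * dx s) + kap *: (x * dy s) &
      forall s, dy (y * s) = s - y * dy s]].
Proof.
have [f [fl fE fK]] := basis_coord (Vi3_basis hV).
pose f1 := f 0; pose f2 := f 1.
have f11 : f1 e1 = 1 := fE 0 0.
have f12 : f1 e2 = 0 := fE 0 1.
have f21 : f2 e1 = 0 := fE 1 0.
have f22 : f2 e2 = 1 := fE 1 1.
have actL h : linear (act h) := (act_bilinear (Vi3_yd hV)).1 h.
have fK2 v : v = f1 v *: e1 + f2 v *: e2.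
  rewrite {1}[v]fK !big_ord_recl big_ord0 addr0 /=.
  by rewrite (_ : lift ord0 ord0 = 1 :> 'I_2) //; apply: val_inj.
have actf (g : V -> k) h v : linear (g : V -> k^o) ->
    g (act h v) = f1 v * g (act h e1) + f2 v * g (act h e2) :> k.
  move=> gl; rewrite {1}[v]fK2.
  by rewrite (linD (actL h)) !(linZ (actL h)) (linD gl) !(linZ gl).
have f1l : linear (f1 : V -> k^o) := fl 0.
have f2l : linear (f2 : V -> k^o) := fl 1.
have fLE : ((forall v, f1 (- v) = - f1 v) * (forall v, f2 (- v) = - f2 v) *
    (forall t v, f1 (t *: v) = (t * f1 v)%R) *
    (forall t v, f2 (t *: v) = (t * f2 v)%R) *
    (f1 0 = 0) * (f2 0 = 0))%type.
  do ![split]; [exact: (linN f1l)|exact: (linN f2l)|exact: (linZ f1l)|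
    exact: (linZ f2l)|exact: (lin0 f1l)|exact: (lin0 f2l)].
exists (skew_der hR f1), (skew_der hR f2); split.
- exact: skew_der_linear.
- exact: skew_der_linear.
- exact: skew_der1.
- exact: skew_der1.
split=> s; rewrite ?skew_der_mulx ?skew_der_muly // ?f11 ?f12 ?f21 ?f22.
- rewrite (@skew_derZ f1 (fun v => f1 (act a v)) (- xi)) => [|v]; last first.
    by rewrite actf // !actE !fLE f11 f12; ring.
  rewrite (@skew_derZ f2 (fun v => f1 (act b v)) (- 1)) => [|v]; last first.
    by rewrite actf // !actE !fLE f11; ring.
  by rewrite -!scalerAr; lmod k; ring.
- rewrite (@skew_derZ f2 (fun v => f2 (act a v)) (- 1)) => [|v]; last first.
    by rewrite actf // !actE !fLE f21 f22; ring.
  rewrite (@skew_derZ f2 (fun v => f2 (act b v)) 0) => [|v]; last first.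
    by rewrite actf // !actE !fLE f21; ring.
  by rewrite -!scalerAr; lmod k; ring.
- rewrite (@skew_derZ f1 (fun v => f1 (act d v)) xi) => [|v]; last first.
    by rewrite actf // !actE !fLE f11 f12; ring.
  rewrite (@skew_derZ f2 (fun v => f1 (act c v)) 1) => [|v]; last first.
    by rewrite actf // !actE !fLE f11; ring.
  by rewrite -!scalerAr; lmod k; ring.
- rewrite (@skew_derZ f2 (fun v => f2 (act d v)) (- 1)) => [|v]; last first.
    by rewrite actf // !actE !fLE f21 f22; ring.
  rewrite (@skew_derZ f2 (fun v => f2 (act c v)) 0) => [|v]; last first.
    by rewrite actf // !actE !fLE f21; ring.
  by rewrite -!scalerAr; lmod k; ring.
Qed.

End V33.

(** * Normal forms *)

(** Products are nested to the right so that left multiplication by x or y often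
    lands syntactically on another entry. *)
Definition monomials (A : pzRingType) (x y : A) : seq A :=
  [:: 1; y; y * y; y * (y * y); x; x * y; x * (y * y); x * (y * (y * y))].

(** The reduction takes place modulo a two-sided ideal I of an algebra A; it is
    applied to the free algebra on x and y. *)
Section NormalForm.
Variables (k : fieldType) (A : lalgType k) (I : A -> Prop) (x y : A).
Hypotheses (I0 : I 0) (I_lin : forall c p q, I p -> I q -> I (c *: p + q))
  (I_mull : forall r p, I p -> I (r * p)) (I_mulr : forall r p, I p -> I (p * r)).
Hypotheses (I_sqr : I (x ^+ 2 - 2%:R *: y ^+ 2)) (I_anti : I (x * y + y * x))
  (I_nil : I (y ^+ 4)).
Hypothesis scaleAr : forall c (p q : A), p * (c *: q) = c *: (p * q).
Local Notation N := (monomials x y).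

Definition reduces (p : A) : Prop :=
  exists c : 'I_8 -> k, I (p - \sum_i c i *: N`_i).
Local Notation S := reduces.

Let S_ideal p : I p -> S p.
Proof.
by exists (fun=> 0); rewrite big1 ?subr0 // => i _; rewrite scale0r.
Qed.

Lemma reduces_lin t p q : S p -> S q -> S (t *: p + q).
Proof.
move=> [c cI] [e eI]; exists (fun i => t * c i + e i).
have := I_lin t cI eI; congr I.
rewrite scalerBr addrACA -opprD scaler_sumr -big_split.
by congr (_ - _); apply: eq_bigr => i _; rewrite scalerDl scalerA.
Qed.

Let S_eqmod p q : I (p - q) -> S q -> S p.
Proof.
by move=> /S_ideal Spq Sq; have := reduces_lin 1 Spq Sq; rewrite scale1r subrK.
Qed.

Let S_monomial (i : 'I_8) : S N`_i.
Proof.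
exists (fun j => (j == i)%:R); rewrite (bigD1 i) //= eqxx scale1r.
by rewrite big1 ?addr0 ?subrr => [|j /negPf ->]; [exact: I0|rewrite scale0r].
Qed.

Let SN n : (n < 8)%N -> S N`_n.
Proof. by move=> lt_n; exact: (S_monomial (Ordinal lt_n)). Qed.

Let sqr_rel u : I (x * (x * u) - 2%:R *: (y * (y * u))).
Proof.
have -> : x * (x * u) - 2%:R *: (y * (y * u)) = (x ^+ 2 - 2%:R *: y ^+ 2) * u.
  by rewrite mulrBl -scalerAl !expr2 -!mulrA.
exact: I_mulr.
Qed.

Let anti_rel u : I (y * (x * u) - (- (x * (y * u)))).
Proof.
have -> : y * (x * u) - (- (x * (y * u))) = (x * y + y * x) * u.
  by rewrite opprK mulrDl -!mulrA addrC.
exact: I_mulr.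
Qed.

Lemma reduces0 : S 0. Proof. exact/S_ideal/I0. Qed.

Let SZ t p : S p -> S (t *: p).
Proof. by move=> Sp; rewrite -[_ *: _]addr0; apply: reduces_lin Sp reduces0. Qed.

Let XX u : S (y * (y * u)) -> S (x * (x * u)).
Proof. by move=> /(SZ 2%:R); apply: S_eqmod (sqr_rel u). Qed.

Let YX u : S (x * (y * u)) -> S (y * (x * u)).
Proof. by move=> /(SZ (-1)); rewrite scaleN1r; apply: S_eqmod (anti_rel u). Qed.

Let I_Y4 : I (y * (y * (y * y))).
Proof. by move: I_nil; rewrite !exprS expr0 mulr1. Qed.

Lemma reduces_mulx (i : 'I_8) : S (x * N`_i).
Proof.
case: i => [[|[|[|[|[|[|[|[|//]]]]]]]] lt_i] /=.
- by rewrite mulr1; exact: (SN (n := 4)).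
- exact: (SN (n := 5)).
- exact: (SN (n := 6)).
- exact: (SN (n := 7)).
- by rewrite -{2}[x]mulr1; apply: XX; rewrite mulr1; exact: (SN (n := 2)).
- by apply: XX; exact: (SN (n := 3)).
- by apply: XX; exact: S_ideal.
- by apply: XX; apply/S_ideal/I_mull.
Qed.

Lemma reduces_muly (i : 'I_8) : S (y * N`_i).
Proof.
case: i => [[|[|[|[|[|[|[|[|//]]]]]]]] lt_i] /=.
- by rewrite mulr1; exact: (SN (n := 1)).
- exact: (SN (n := 2)).
- exact: (SN (n := 3)).
- exact: S_ideal.
- by rewrite -[x]mulr1; apply: YX; rewrite mulr1; exact: (SN (n := 5)).
- by apply: YX; exact: (SN (n := 6)).
- by apply: YX; exact: (SN (n := 7)).
- by apply: YX; apply/S_ideal/I_mull.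
Qed.

Lemma reduces1 : S 1. Proof. exact: (SN (n := 0)). Qed.

(** Since reducible elements contain 1 and are closed under linear combinations
    and under this multiplication, every word in x and y is reducible. *)
Lemma reduces_mul_gen g : (g = x \/ g = y) -> forall p, S p -> S (g * p).
Proof.
move=> gxy p [c cI]; apply: (S_eqmod (q := \sum_i c i *: (g * N`_i))).
  have := I_mull g cI; rewrite mulrBr mulr_sumr.
  by congr (I (_ - _)); apply: eq_bigr => i _; rewrite scaleAr.
apply: (big_ind S) => [|p1 p2|i _]; first exact: reduces0.
  by move=> S1 S2; rewrite -[p1]scale1r; apply: reduces_lin.
by apply: SZ; case: gxy => ->; [apply: reduces_mulx|apply: reduces_muly].
Qed.
End NormalForm.

Lemma freeAlg_scalerAr (k : fieldType) n c (p q : freeAlg k n) :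
  p * (c *: q) = c *: (p * q).
Proof.
have central : p * c%:MP = c%:MP * p.
  rewrite !malgM_def fgmulgU fgmulUg; apply: eq_bigr => m _.
  by rewrite mulm1 mul1m mulrC.
by rewrite -[c *: q]mul_malgC mulrA central -mulrA mul_malgC.
Qed.

Lemma normal_form (k : fieldType) (p : freeAlg k 2) :
  exists c : 'I_8 -> k, two_sided_ideal (nichols_rels k)
    (p - \sum_i c i *: (monomials (fgen k 0) (fgen k 1))`_i).
Proof.
suff : reduces (two_sided_ideal (nichols_rels k)) (fgen k 0) (fgen k 1) p by [].
have fgen_xy (j : 'I_2) : fgen k j = fgen k 0 \/ fgen k j = fgen k 1.
  by case: j => [[|[|//]] lt_j]; [left|right]; congr fgen; apply: val_inj.
elim/freeAlg_ind: p.
- by apply: reduces0; exact: ideal0.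
- by apply: reduces1; exact: ideal0.
- by apply: reduces_lin; exact: ideal_lin.
- move=> j p; apply: reduces_mul_gen.
  + exact: ideal0.
  + exact: ideal_lin.
  + exact: ideal_mull.
  + exact: ideal_mulr.
  + by apply: ideal_gen; rewrite mem_head.
  + by apply: ideal_gen; rewrite !inE; apply/or3P/Or32/eqxx.
  + by apply: ideal_gen; rewrite !inE; apply/or3P/Or33/eqxx.
  + exact: freeAlg_scalerAr.
  + exact: fgen_xy.
Qed.

(** * Independence of the monomials, and the presentation *)

(** In a relation r, with c_n the coefficient of the n-th monomial, dx dx dx dy r
    is xi kappa c_7; going back through dx dx dy r, dx dy r and dy r kills the
    other odd-indexed coefficients.  The remaining part of r is a combination
    of 1, y^2, x and x y^2, killed in the same way by dx alone. *)
Lemma monomials_free (k : fieldType) (xi : k) (A : algType k) (x y : A)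
    (dx dy : A -> A) :
  2%:R != 0 :> k -> 4.-primitive_root xi ->
  y * x = - (x * y) -> x * x = 2%:R *: (y * y) ->
  linear dx -> linear dy -> dx 1 = 0 -> dy 1 = 0 ->
  (forall s, dx (x * s) = s - xi *: (x * dx s) - (1 + xi) *: (y * dy s)) ->
  (forall s, dy (x * s) = - (x * dy s)) ->
  (forall s, dx (y * s) = xi *: (y * dx s) + kappa xi *: (x * dy s)) ->
  (forall s, dy (y * s) = s - y * dy s) ->
  forall c : 'I_8 -> k, \sum_i c i *: (monomials x y)`_i = 0 -> forall i, c i = 0.
Proof.
move=> two_neq0 xi_root yx xx dxl dyl dx1 dy1 dxx dyx dxy dyy c.
have xi2 := xi_sqr xi_root.
have dxE := (linD dxl, linN dxl, linZ dxl, lin0 dxl).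
have dyE := (linD dyl, linN dyl, linZ dyl, lin0 dyl).
have normE := (mulr0, mulr1, mulrN, mulrDr, =^~scalerAr, yx, xx).
have dx_x : dx x = 1 by rewrite -[x]mulr1 dxx dx1 dy1 !mulr0 !scaler0 !subr0.
have dy_x : dy x = 0 by rewrite -[x]mulr1 dyx dy1 mulr0 oppr0.
have dx_y : dx y = 0 by rewrite -[y]mulr1 dxy dx1 dy1 !mulr0 !scaler0 addr0.
have dy_y : dy y = 1 by rewrite -[y]mulr1 dyy dy1 mulr0 subr0.
have dx_y2 : dx (y * y) = kappa xi *: x.
  by rewrite dxy dx_y dy_y !normE; lmod k; ring.
have dy_y2 : dy (y * y) = 0 by rewrite dyy dy_y mulr1 subrr.
have dy_y3 : dy (y * (y * y)) = y * y by rewrite dyy dy_y2 mulr0 subr0.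
have dx_xy2 : dx (x * (y * y)) = - xi *: (y * y).
  rewrite dxx dx_y2 dy_y2 !normE; lmod k.
  by rewrite /kappa; field: xi2.
have kap_neq0 : kappa xi != 0.
  apply/eqP => e; have := kap_sqr two_neq0 xi_root; rewrite e !mulr0 => /esym/eqP.
  by rewrite oppr_eq0 (negPf (xi_neq0 xi_root)).
have one_neq0 t : t *: (1 : A) = 0 -> t = 0.
  by move=> /eqP; rewrite scaler_eq0 oner_eq0 orbF => /eqP.
have [c' cE] : exists c' : nat -> k, forall i : 'I_8, c i = c' i.
  by exists (fun n => c (inord n)) => i; rewrite inord_val.
rewrite (eq_bigr (fun i : 'I_8 => c' i *: (monomials x y)`_i)); last first.
  by move=> i _; rewrite cE.
rewrite !big_ord_recl big_ord0 /= /bump /= => r0.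
have dy_r : c' 1 *: 1 - c' 5 *: x + c' 3 *: (y * y) - c' 7 *: (x * (y * y)) = 0.
  have := congr1 dy r0; rewrite !dyE !(dyx, dy_x) dy1 dy_y dy_y2 dy_y3 => <-.
  by rewrite !normE; lmod k; ring.
have dx_dy_r : - c' 5 *: 1 + (c' 3 * kappa xi) *: x + (c' 7 * xi) *: (y * y) = 0.
  have := congr1 dx dy_r; rewrite !dxE dx1 dx_x dx_y2 dx_xy2 => <-.
  by lmod k; ring.
have dx2_dy_r : (c' 3 * kappa xi) *: 1 + (c' 7 * xi * kappa xi) *: x = 0.
  have := congr1 dx dx_dy_r; rewrite !dxE dx1 dx_x dx_y2 => <-.
  by lmod k; ring.
have c7 : c' 7 = 0.
  have := congr1 dx dx2_dy_r; rewrite !dxE dx1 dx_x scaler0 add0r => /one_neq0/eqP.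
  by rewrite 2!mulf_eq0 (negPf kap_neq0) (negPf (xi_neq0 xi_root)) !orbF => /eqP.
have c3 : c' 3 = 0.
  move: dx2_dy_r; rewrite c7 !mul0r scale0r addr0 => /one_neq0/eqP.
  by rewrite mulf_eq0 (negPf kap_neq0) orbF => /eqP.
have c5 : c' 5 = 0.
  move: dx_dy_r; rewrite c7 c3 !mul0r !scale0r !addr0 => /one_neq0/eqP.
  by rewrite oppr_eq0 => /eqP.
have c1 : c' 1 = 0.
  by move: dy_r; rewrite c7 c3 c5 !scale0r !subr0 !addr0 => /one_neq0.
have dx_r : c' 4 *: 1 + (c' 2 * kappa xi) *: x - (c' 6 * xi) *: (y * y) = 0.
  have := congr1 dx r0; rewrite c1 c3 c5 c7 !scale0r !dxE dx1 dx_x dx_y2 dx_xy2 => <-.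
  by lmod k; ring.
have dx2_r : (c' 2 * kappa xi) *: 1 - (c' 6 * xi * kappa xi) *: x = 0.
  have := congr1 dx dx_r; rewrite !dxE dx1 dx_x dx_y2 => <-.
  by lmod k; ring.
have c6 : c' 6 = 0.
  have := congr1 dx dx2_r; rewrite !dxE dx1 dx_x scaler0 add0r -scaleNr => /one_neq0/eqP.
  by rewrite oppr_eq0 2!mulf_eq0 (negPf kap_neq0) (negPf (xi_neq0 xi_root)) !orbF => /eqP.
have c2 : c' 2 = 0.
  move: dx2_r; rewrite c6 !mul0r scale0r subr0 => /one_neq0/eqP.
  by rewrite mulf_eq0 (negPf kap_neq0) orbF => /eqP.
have c4 : c' 4 = 0.
  by move: dx_r; rewrite c6 c2 !mul0r !scale0r subr0 addr0 => /one_neq0.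
have c0 : c' 0 = 0.
  by move: r0; rewrite c1 c2 c3 c4 c5 c6 c7 !scale0r !addr0 => /one_neq0.
by case=> [[|[|[|[|[|[|[|[|//]]]]]]]] lt_i]; rewrite cE.
Qed.

(* Stating these for arbitrary p and q keeps unification from unfolding the
   generators of the free algebra into products. *)
Section EvalRelations.
Variables (k : fieldType) (A : algType k) (g : 'I_2 -> A) (p q : freeAlg k 2).
Local Notation x := (feval g p).
Local Notation y := (feval g q).
Let fl := feval_linear g.

Lemma feval_monomials (i : 'I_8) :
  feval g (monomials p q)`_i = (monomials x y)`_i.
Proof.
by case: i => [[|[|[|[|[|[|[|[|//]]]]]]]] lt_i]; rewrite /= ?fevalM ?feval1.
Qed.

Lemma feval_sqr_rel :
  feval g (p ^+ 2 - 2%:R *: q ^+ 2) = x * x - 2%:R *: (y * y).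
Proof. by rewrite (linB fl) (linZ fl) !expr2 (fevalM g p p) (fevalM g q q). Qed.

Lemma feval_anti_rel : feval g (p * q + q * p) = x * y + y * x.
Proof. by rewrite (linD fl) (fevalM g p q) (fevalM g q p). Qed.

Lemma feval_nil_rel : feval g (q ^+ 4) = y * (y * (y * y)).
Proof. by rewrite !exprS expr0 mulr1 !fevalM. Qed.
End EvalRelations.

Lemma feval_nichols_rels (k : fieldType) (A : algType k) (g : 'I_2 -> A) :
  let x := g 0 in let y := g 1 in
  y * x = - (x * y) -> x * x = 2%:R *: (y * y) -> y * (y * (y * y)) = 0 ->
  forall p, p \in nichols_rels k -> feval g p = 0.
Proof.
move=> x y yx xx y4 p; rewrite !inE => /or3P[] /eqP ->.
- by rewrite feval_sqr_rel !feval_gen -/x -/y xx subrr.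
- by rewrite feval_anti_rel !feval_gen -/x -/y yx subrr.
- by rewrite feval_nil_rel !feval_gen.
Qed.

Theorem proposition4p11 (k : closedFieldType) (hk : [pchar k] =i pred0)
    (xi : k) (hxi : 4.-primitive_root xi)
    (K : hopfData k) (a b c d : K) (hK : is_calK xi a b c d)
    (V : ydData K) (e1 e2 : V) (hV : is_Vi3 xi a b c d (xi ^+ 3) e1 e2)
    (R : bhopfData K) (G : nat -> R -> Prop) (iota : V -> R)
    (hR : is_nichols G iota) :
  presented (fun j : 'I_2 => [:: iota e1; iota e2]`_j) (nichols_rels k) /\
  has_dim R 8.
Proof.
have two_neq0 : 2%:R != 0 :> k by apply/negP => two0; have := hk 2; rewrite !inE two0.
have yx := anticomm hxi hK hV hR.
have xx := x_sqr two_neq0 hxi hK hV hR.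
have y4 := y_pow4 two_neq0 hxi hK hV hR.
have [dx [dy [dxl dyl dx1 dy1 [dxx dyx dxy dyy]]]] := skew_derivations hxi hV hR.
apply: (@presented_of_monomials k 2 R _ (nichols_rels k) 8
  (fun i => (monomials (fgen k 0) (fgen k 1))`_i)).
- move=> P Pg P1 PL PM; apply: (nichols_generated hR) => // w.
  move=> /(nichols1_image hR) [v ->].
  have [f [_ _ fK]] := basis_coord (Vi3_basis hV); rewrite [v]fK.
  have P0 : P 0 by rewrite -(addNr (1 : R)) -scaleN1r; apply: PL.
  rewrite (lin_sum (iota_linear hR)); apply: (big_ind P) => [//|r s Pr Ps|j _].
    by rewrite -[r]scale1r; apply: PL.
  rewrite (linZ (iota_linear hR)) -[_ *: _]addr0; apply: PL => //.
  by apply: Pg; exists j; case: j => [[|[|//]] lt_j].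
- exact: feval_nichols_rels.
- exact: normal_form.
- move=> e er; apply: (monomials_free two_neq0 hxi yx xx dxl dyl dx1 dy1 dxx dyx dxy dyy).
  rewrite -[RHS]er; apply: eq_bigr => i _; congr (_ *: _).
  by rewrite feval_monomials !feval_gen.
Qed.
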